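(* Let $M$ be an invariant submanifold of an $(LCS)_n$-manifold $\widetilde{M}$ admitting quarter symmetric metric connection, and suppose $\alpha\neq1$ (at every point). Then the second fundamental form $\sigma$ of $M$ is 2-recurrent with respect to the quarter symmetric metric connection if and only if $M$ is totally geodesic with respect to the Levi-Civita connection.
   Context: An $(LCS)_n$-manifold (Lorentzian concircular structure manifold) is an $n$-dimensional Lorentzian manifold $(\widetilde{M},g)$, signature $(-,+,\dots,+)$, with Levi-Civita connection $\widetilde{\nabla}$, together with a unit timelike vector field $\xi$ (so $g(\xi,\xi)=-1$), the 1-form $\eta(X)=g(X,\xi)$, and a nowhere zero smooth function $\alpha$ such that $\widetilde{\nabla}_X\xi=\alpha\{X+\eta(X)\xi\}$, equivalently $(\widetilde{\nabla}_X\eta)(Y)=\alpha\{g(X,Y)+\eta(X)\eta(Y)\}$, and $X\alpha=\rho\,\eta(X)$ for all $X$, where $\rho=-(\xi\alpha)$. The structure tensor is the $(1,1)$ tensor $\phi X=\frac1\alpha\widetilde{\nabla}_X\xi=X+\eta(X)\xi$. The quarter symmetric metric connection on $\widetilde{M}$ is $\overline{\widetilde{\nabla}}_XY=\widetilde{\nabla}_XY+\eta(Y)\phi X-g(\phi X,Y)\xi$. A submanifold $M$ of dimension $m<n$ with induced metric (also denoted $g$) is invariant if $\xi$ is tangent to $M$ at every point of $M$ and $\phi(TM)\subset TM$. For $X,Y$ tangent to $M$: $\widetilde{\nabla}_XY=\nabla_XY+\sigma(X,Y)$ (tangential and normal parts), where $\sigma$ is the second fundamental form; $\overline{\nabla}_XY$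 is the tangential part of $\overline{\widetilde{\nabla}}_XY$; and for $V$ normal, $\overline{\nabla}^\perp_XV$ is the normal part of $\overline{\widetilde{\nabla}}_XV$. $M$ is totally geodesic with respect to the Levi-Civita connection if $\sigma=0$. First and second covariant derivatives of $\sigma$ with respect to the quarter symmetric metric connection, for vector fields $X,Y,Z,W$ tangent to $M$: $(\overline{\widetilde{\nabla}}_X\sigma)(Y,Z)=\overline{\nabla}^\perp_X(\sigma(Y,Z))-\sigma(\overline{\nabla}_XY,Z)-\sigma(Y,\overline{\nabla}_XZ)$, $(\overline{\widetilde{\nabla}}_X\overline{\widetilde{\nabla}}_Y\sigma)(Z,W)=\overline{\nabla}^\perp_X((\overline{\widetilde{\nabla}}_Y\sigma)(Z,W))-(\overline{\widetilde{\nabla}}_Y\sigma)(\overline{\nabla}_XZ,W)-(\overline{\widetilde{\nabla}}_X\sigma)(Z,\overline{\nabla}_YW)-(\overline{\widetilde{\nabla}}_{\overline{\nabla}_XY}\sigma)(Z,W)$. $\sigma$ is 2-recurrent with respect to the quarter symmetric metric connection if there is a $(0,2)$-tensor field $\psi$ on $M$ with $(\overline{\widetilde{\nabla}}_X\overline{\widetilde{\nabla}}_Y\sigma)(Z,W)=\psi(X,Y)\sigma(Z,W)$ for all vector fields $X,Y,Z,W$ tangent to $M$. *)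

(* Defs.v *)
From mathcomp Require Import all_boot all_order all_algebra.
From mathcomp Require Import all_classical all_reals all_analysis.
Import Order.TTheory GRing.Theory Num.Theory numFieldNormedType.Exports.

Set Implicit Arguments.
Unset Strict Implicit.
Unset Printing Implicit Defensive.

Local Open Scope classical_set_scope.
Local Open Scope ring_scope.

Section Euclidean.
Context {R : realType} {n : nat}.

Definition partial (j : 'I_n) (h : 'rV[R]_n -> R) : 'rV[R]_n -> R :=
  fun x => 'd h x (delta_mx 0 j).

Definition iter_partial (js : seq 'I_n) (h : 'rV[R]_n -> R) : 'rV[R]_n -> R :=
  foldr partial h js.

(* [h] is of class C^oo on a neighbourhood of [x]; the neighbourhood does not
   depend on the order of differentiation. *)
Definition smooth_at (h : 'rV[R]_n -> R) (x : 'rV[R]_n) : Prop :=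
  \forall y \near x, forall js, differentiable (iter_partial js h) y.

End Euclidean.

(* The smooth structure is given by an atlas with one chart [chart p] selected
   around every point [p]; any smooth atlas contains such a subatlas, which
   spans the same maximal atlas.  [chart p] and [chart_inv p] are total
   functions, meaningful only on [chart_dom p] and on its (open) image.  *)
Record manifold (R : realType) (n : nat) := Manifold {
  space :> topologicalType ;
  chart_dom : space -> set space ;
  chart : space -> space -> 'rV[R]_n ;
  chart_inv : space -> 'rV[R]_n -> space ;
  manifold_hausdorff : hausdorff_space space ;
  manifold_countable : @second_countable space ;
  chart_dom_open : forall p, open (chart_dom p) ;
  chart_dom_mem : forall p, chart_dom p p ;
  chart_img_open : forall p, open (chart p @` chart_dom p) ;
  chartK : forall p q, chart_dom p q -> chart_inv p (chart p q) = q ;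
  chart_continuous : forall p q, chart_dom p q ->
    {for q, continuous (chart p)} ;
  chart_inv_continuous : forall p q, chart_dom p q ->
    {for chart p q, continuous (chart_inv p)} ;
  chart_smooth : forall p q r (j : 'I_n), chart_dom p r -> chart_dom q r ->
    smooth_at (fun x => chart q (chart_inv p x) 0 j) (chart p r)
}.

(* A tangent vector at [p] is represented by its components in the selected
   chart [chart p]; hence T_p M is ['rV_n] and a (not necessarily smooth)
   vector field is a function [M -> 'rV_n].  The components of the field in any
   other chart are obtained by differentiating the coordinates along it. *)
Section Calculus.
Context {R : realType}.

Definition smooth_fun_at n (M : manifold R n) (f : M -> R) (p : M) : Prop :=
  smooth_at (f \o chart_inv p) (chart p p).

Definition smooth_fun n (M : manifold R n) (f : M -> R) : Prop :=
  forall p, smooth_fun_at f p.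

(* derivative of [f] at [p] along [v] in T_p M *)
Definition dir n (M : manifold R n) (p : M) (v : 'rV[R]_n) (f : M -> R) : R :=
  'd (f \o chart_inv p) (chart p p) v.

Definition smooth_map m n (M : manifold R m) (N : manifold R n) (F : M -> N)
    : Prop :=
  continuous F /\
  forall p (j : 'I_n),
    smooth_at (fun x => chart (F p) (F (chart_inv p x)) 0 j) (chart p p).

(* the differential T_p M -> T_{F p} N *)
Definition tmap m n (M : manifold R m) (N : manifold R n) (F : M -> N) (p : M)
    (v : 'rV[R]_m) : 'rV[R]_n :=
  'd (fun x => chart (F p) (F (chart_inv p x))) (chart p p) v.

Definition immersion m n (M : manifold R m) (N : manifold R n) (F : M -> N)
    : Prop :=
  smooth_map F /\ forall p, injective (tmap F p).

(* [V] is a section of F^*TN, that is V q is in T_{F q} N; it is smooth near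
   [p] when its components in the chart of N around [F p] are. *)
Definition smooth_along_at m n (M : manifold R m) (N : manifold R n)
    (F : M -> N) (V : M -> 'rV[R]_n) (p : M) : Prop :=
  forall j : 'I_n,
    smooth_fun_at (fun q => dir (F q) (V q) (fun r : N => chart (F p) r 0 j)) p.

Definition smooth_vf_at n (M : manifold R n) (X : M -> 'rV[R]_n) (p : M)
    : Prop :=
  smooth_along_at (fun q : M => q) X p.

Definition smooth_vf n (M : manifold R n) (X : M -> 'rV[R]_n) : Prop :=
  forall p, smooth_vf_at X p.

Definition form n (B : 'M[R]_n) (u v : 'rV[R]_n) : R := (u *m B *m v^T) 0 0.

(* a smooth (0,2)-tensor field, given at [p] by its matrix in [chart p] *)
Definition smooth_tensor2 n (M : manifold R n) (B : M -> 'M[R]_n) : Prop :=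
  forall (X Y : M -> 'rV[R]_n) p, smooth_vf_at X p -> smooth_vf_at Y p ->
    smooth_fun_at (fun q => form (B q) (X q) (Y q)) p.

(* A connection D on F^*TN; [D p v V] is the covariant derivative at [p] of the
   section [V] along [v] in T_p M.  As usual it acts on local sections: the
   axioms only constrain its values on sections that are smooth near [p]. *)
Record connection_along m n (M : manifold R m) (N : manifold R n) (F : M -> N)
    (D : forall p : M, 'rV[R]_m -> (M -> 'rV[R]_n) -> 'rV[R]_n) : Prop :=
  ConnectionAlong {
  conn_linear : forall p (a : R) (u v : 'rV[R]_m) V,
    D p (a *: u + v) V = a *: D p u V + D p v V ;
  conn_add : forall p v V W,
    smooth_along_at F V p -> smooth_along_at F W p ->
    D p v (fun q => V q + W q) = D p v V + D p v W ;
  conn_leibniz : forall p v (f : M -> R) V,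
    smooth_fun_at f p -> smooth_along_at F V p ->
    D p v (fun q => f q *: V q) = dir p v f *: V p + f p *: D p v V ;
  conn_smooth : forall p (X : M -> 'rV[R]_m) V,
    smooth_vf_at X p -> smooth_along_at F V p ->
    smooth_along_at F (fun q => D q (X q) V) p
}.

(* [D] is the connection induced on F^*TN by the connection [nabla] of N: the
   unique one with D_v (Y o F) = nabla_{dF v} Y. *)
Definition pullback_connection m n (M : manifold R m) (N : manifold R n)
    (F : M -> N)
    (nabla : N -> 'rV[R]_n -> (N -> 'rV[R]_n) -> 'rV[R]_n)
    (D : M -> 'rV[R]_m -> (M -> 'rV[R]_n) -> 'rV[R]_n) : Prop :=
  connection_along F D /\
  forall p v (Y : N -> 'rV[R]_n), smooth_vf_at Y (F p) ->
    D p v (Y \o F) = nabla (F p) (tmap F p v) Y.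

(* Torsion-freeness is nabla_X Y - nabla_Y X = [X, Y], tested on functions,
   with [X, Y] f = X (Y f) - Y (X f). *)
Record levi_civita n (N : manifold R n) (g : N -> 'M[R]_n)
    (nabla : N -> 'rV[R]_n -> (N -> 'rV[R]_n) -> 'rV[R]_n) : Prop :=
  LeviCivita {
  lc_connection : connection_along (fun q : N => q) nabla ;
  lc_torsion_free : forall p (X Y : N -> 'rV[R]_n) (f : N -> R),
    smooth_vf_at X p -> smooth_vf_at Y p -> smooth_fun_at f p ->
    dir p (nabla p (X p) Y - nabla p (Y p) X) f =
    dir p (X p) (fun q => dir q (Y q) f)
    - dir p (Y p) (fun q => dir q (X q) f) ;
  lc_metric : forall p v (Y Z : N -> 'rV[R]_n),
    smooth_vf_at Y p -> smooth_vf_at Z p ->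
    dir p v (fun q => form (g q) (Y q) (Z q)) =
    form (g p) (nabla p v Y) (Z p) + form (g p) (Y p) (nabla p v Z)
}.

Definition lorentzian n (N : manifold R n) (g : N -> 'M[R]_n) : Prop :=
  smooth_tensor2 g /\
  forall p, exists P : 'M[R]_n, P \in unitmx /\
    P *m g p *m P^T = diag_mx (\row_(j < n) if j == 0%N :> nat then -1 else 1).

End Calculus.

Record LCS_manifold (R : realType) (n : nat) := LCSManifold {
  lcs_manifold :> manifold R n ;
  metric : lcs_manifold -> 'M[R]_n ;
  nabla : lcs_manifold -> 'rV[R]_n -> (lcs_manifold -> 'rV[R]_n) -> 'rV[R]_n ;
  xi : lcs_manifold -> 'rV[R]_n ;
  alpha : lcs_manifold -> R ;
  metric_lorentzian : lorentzian metric ;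
  nabla_levi_civita : levi_civita metric nabla ;
  xi_smooth : smooth_vf xi ;
  xi_unit : forall p, form (metric p) (xi p) (xi p) = -1 ;
  alpha_smooth : smooth_fun alpha ;
  alpha_neq0 : forall p, alpha p != 0 ;
  nabla_xi : forall p v,
    nabla p v xi = alpha p *: (v + form (metric p) v (xi p) *: xi p) ;
  alpha_dir : forall p v,
    dir p v alpha = - dir p (xi p) alpha * form (metric p) v (xi p)
}.

Section Submanifold.
Context {R : realType} {n : nat} (N : LCS_manifold R n).

Definition eta (p : N) (v : 'rV[R]_n) : R := form (metric p) v (xi p).

Definition phi (p : N) (v : 'rV[R]_n) : 'rV[R]_n := v + eta p v *: xi p.

Context {m : nat} (M : manifold R m) (i : M -> N).
Variable D : M -> 'rV[R]_m -> (M -> 'rV[R]_n) -> 'rV[R]_n.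
Implicit Types (p : M) (X Y Z W : M -> 'rV[R]_m) (V : M -> 'rV[R]_n).

(* The quarter symmetric metric connection induced along [i], when [D] is
   induced by the Levi-Civita connection: for a field V = Y o i it takes v to
   nabla_u Y + eta(Y) phi(u) - g(phi(u), Y) xi, where u = di(v). *)
Definition qsm p (v : 'rV[R]_m) V : 'rV[R]_n :=
  D p v V + eta (i p) (V p) *: phi (i p) (tmap i p v)
  - form (metric (i p)) (phi (i p) (tmap i p v)) (V p) *: xi (i p).

(* The tangential part of [w] in T_{i p} N, as a vector of T_p M; it is well
   defined as soon as the metric is nondegenerate on the tangent space. *)
Definition tan_part p (w : 'rV[R]_n) : 'rV[R]_m :=
  xget 0 [set t | forall u,
    form (metric (i p)) (w - tmap i p t) (tmap i p u) = 0].

Definition nor_part p (w : 'rV[R]_n) : 'rV[R]_n :=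
  w - tmap i p (tan_part p w).

Definition pushf X : M -> 'rV[R]_n := fun p => tmap i p (X p).

Definition invariant_sub : Prop :=
  (forall p, exists t, tmap i p t = xi (i p)) /\
  (forall p v, exists w, tmap i p w = phi (i p) (tmap i p v)).

Definition sigma X Y : M -> 'rV[R]_n :=
  fun p => nor_part p (D p (X p) (pushf Y)).

Definition qsm_tan X Y : M -> 'rV[R]_m :=
  fun p => tan_part p (qsm p (X p) (pushf Y)).

Definition qsm_nor X V : M -> 'rV[R]_n :=
  fun p => nor_part p (qsm p (X p) V).

Definition cov_sigma X Y Z : M -> 'rV[R]_n :=
  fun p => qsm_nor X (sigma Y Z) p - sigma (qsm_tan X Y) Z p
           - sigma Y (qsm_tan X Z) p.

(* The third term is (D_X sigma)(Z, D_Y W), with X and Y in this order. *)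
Definition cov2_sigma X Y Z W : M -> 'rV[R]_n :=
  fun p => qsm_nor X (cov_sigma Y Z W) p - cov_sigma Y (qsm_tan X Z) W p
           - cov_sigma X Z (qsm_tan Y W) p - cov_sigma (qsm_tan X Y) Z W p.

Definition two_recurrent : Prop :=
  exists psi : M -> 'M[R]_m, smooth_tensor2 psi /\
    forall X Y Z W, smooth_vf X -> smooth_vf Y -> smooth_vf Z -> smooth_vf W ->
    forall p, cov2_sigma X Y Z W p = form (psi p) (X p) (Y p) *: sigma Z W p.

Definition totally_geodesic : Prop :=
  forall X Y, smooth_vf X -> smooth_vf Y -> forall p, sigma X Y p = 0.

End Submanifold.

(* Main.v *)
Require Import Defs.
From mathcomp Require Import all_boot all_order all_algebra.
From mathcomp Require Import all_classical all_reals all_analysis.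
From mathcomp Require Import ring.
Import Order.TTheory GRing.Theory Num.Theory numFieldNormedType.Exports.

(* The extra terms of the quarter symmetric connection are tangent to M and
   vanish on normal fields, and nabla_X xi = alpha phi X is tangent, so
   sigma(X, xi) = 0 and the induced connection satisfies
   nabla'_X xi = (alpha - 1) phi X, in particular nabla'_xi xi = 0.  Hence in
   (D_X D_xi sigma)(Z, xi) only sigma(Z, nabla'_{nabla'_X xi} xi) survives,
   which is (alpha - 1)^2 sigma(Z, X); 2-recurrence equates it with
   psi(X, xi) sigma(Z, xi) = 0.  Conversely, if sigma = 0 then psi = 0 works,
   since the tangential part of a smooth field is again smooth: its components
   in a frame are given by the inverse of the Gram matrix, invertible because
   the tangent spaces of M contain the timelike vector xi. *)

Set Implicit Arguments.
Unset Strict Implicit.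
Unset Printing Implicit Defensive.

Local Notation form := Defs.form.

Local Open Scope classical_set_scope.
Local Open Scope ring_scope.

(** * Smooth functions on open sets of R^n *)

Section NearDiff.
Context {R : realType} {V W : normedModType R}.
Implicit Types (f g : V -> W) (x : V).

(** A first-order expansion depends only on the germ at [x], so the expansion of [f] also serves for
    [g]. Uniqueness of the differential then gives ['d g x = 'd f x], and differentiability of [g]
    follows. *)
Lemma near_eq_diff_expansion f g x : (\forall y \near x, f y = g y) ->
  differentiable f x -> g \o shift x = cst (g x) + 'd f x +o_ 0 id.
Proof.
move=> fg /diff_locally/eqaddoP df; apply/eqaddoP => e e0.
move: (df e e0); apply: filter_app.
have : \forall h \near 0, f (h + x) = g (h + x).
  by move: fg; rewrite (near_shift 0 x) /= subr0.
apply: filter_app; near=> h => fgh.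
by rewrite !fctE /= -(nbhs_singleton fg) fgh.
Unshelve. all: by end_near. Qed.

Lemma near_eq_diff f g x : (\forall y \near x, f y = g y) ->
  differentiable f x -> 'd g x = 'd f x :> (V -> W).
Proof.
move=> fg df; apply: diff_unique; first exact: diff_continuous.
exact: near_eq_diff_expansion.
Qed.

Lemma near_eq_differentiable f g x : (\forall y \near x, f y = g y) ->
  differentiable f x -> differentiable g x.
Proof.
move=> fg df; apply/diff_locallyP; rewrite (near_eq_diff fg df); split.
  exact: diff_continuous.
exact: near_eq_diff_expansion.
Qed.

End NearDiff.

Section SmoothOn.
Context {R : realType}.

(* Locality in the open set [U] makes the Leibniz and chain rules usable as
   equations on [U] in inductions over the order [k]. *)
Fixpoint smooth_on n (k : nat) (U : set 'rV[R]_n) (h : 'rV[R]_n -> R) : Prop :=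
  (forall y, U y -> differentiable h y) /\
  if k is k'.+1 then forall j, smooth_on k' U (partial j h) else True.

Lemma smooth_on_differentiable n k (U : set 'rV[R]_n) h y :
  smooth_on k U h -> U y -> differentiable h y.
Proof. by case: k => [|k] [dh _]; exact: dh. Qed.

Lemma smooth_on_partial n k (U : set 'rV[R]_n) h j :
  smooth_on k.+1 U h -> smooth_on k U (partial j h).
Proof. by case=> _; apply. Qed.

Lemma smooth_onW n k (U : set 'rV[R]_n) h :
  smooth_on k.+1 U h -> smooth_on k U h.
Proof.
elim: k h => [|k IH] h [dh sh]; first by split.
by split=> // j; apply: IH.
Qed.

(** [smooth_on] peels off the derivative taken first, which is the last index of the list in
    [iter_partial]; hence the induction from the right end of [js]. *)
Lemma smooth_onP n (U : set 'rV[R]_n) h :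
  (forall k, smooth_on k U h) <->
  (forall y, U y -> forall js, differentiable (iter_partial js h) y).
Proof.
split.
  move=> sh y Uy js; elim/last_ind: js h sh => [|js j IH] h sh.
    exact: smooth_on_differentiable (sh 0%N) Uy.
  by rewrite /iter_partial foldr_rcons; apply: IH => k; apply/smooth_on_partial.
move=> sh k; elim: k h sh => [|k IH] h sh; split=> //.
1,2: by move=> y Uy; exact: (sh y Uy [::]).
move=> j; apply: IH => y Uy js.
by have := sh y Uy (rcons js j); rewrite /iter_partial foldr_rcons.
Qed.

Lemma smooth_on_sub n k (U V : set 'rV[R]_n) h :
  V `<=` U -> smooth_on k U h -> smooth_on k V h.
Proof.
move=> VU; elim: k h => [|k IH] h [dh sh]; split=> //.
1,2: by move=> y /VU /dh.
by move=> j; exact: (IH _ (sh j)).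
Qed.

(** Openness turns equality on [U] into equality near each point of [U], so the partial derivatives
    agree on [U] too and the induction continues. *)
Lemma eq_smooth_on n k (U : set 'rV[R]_n) f g : open U ->
  (forall y, U y -> f y = g y) -> smooth_on k U f -> smooth_on k U g.
Proof.
move=> oU; elim: k f g => [|k IH] f g fg [df sf].
  split=> // y Uy; apply: near_eq_differentiable (df y Uy).
  by apply: filterS (open_nbhs_nbhs (conj oU Uy)).
have fgn y : U y -> \forall z \near y, f z = g z.
  by move=> Uy; apply: filterS (open_nbhs_nbhs (conj oU Uy)).
split=> [y Uy|j]; first exact: near_eq_differentiable (fgn y Uy) (df y Uy).
apply: IH (sf j) => y Uy.
by rewrite /partial (near_eq_diff (fgn y Uy) (df y Uy)).
Qed.

Lemma smooth_on_cst n k (U : set 'rV[R]_n) c : smooth_on k U (cst c).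
Proof.
elim: k c => [|k IH] c; split=> // j.
suff -> : partial j (cst c : 'rV[R]_n -> R) = cst 0 by [].
by apply/funext => x; rewrite /partial diff_cst.
Qed.

Lemma smooth_onD n k (U : set 'rV[R]_n) f g : open U ->
  smooth_on k U f -> smooth_on k U g -> smooth_on k U (fun x => f x + g x).
Proof.
move=> oU; elim: k f g => [|k IH] f g [df sf] [dg sg].
  by split=> // y Uy; apply: differentiableD; [exact: df|exact: dg].
split=> [y Uy|j]; first by apply: differentiableD; [exact: df|exact: dg].
apply: eq_smooth_on (IH _ _ (sf j) (sg j)) => // y Uy.
have /(congr1 (@^~ (delta_mx 0 j))) e := diffD (df y Uy) (dg y Uy).
exact: (esym e).
Qed.

Lemma smooth_onM n k (U : set 'rV[R]_n) f g : open U ->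
  smooth_on k U f -> smooth_on k U g -> smooth_on k U (fun x => f x * g x).
Proof.
move=> oU; elim: k f g => [|k IH] f g sf sg.
  case: sf sg => df _ [dg _].
  by split=> // y Uy; apply: differentiableM; [exact: df|exact: dg].
have [[df sf'] [dg sg']] := (sf, sg).
split=> [y Uy|j]; first by apply: differentiableM; [exact: df|exact: dg].
apply: eq_smooth_on (smooth_onD oU (IH _ _ (smooth_onW sf) (sg' j))
  (IH _ _ (smooth_onW sg) (sf' j))) => // y Uy.
have /(congr1 (@^~ (delta_mx 0 j))) e := diffM (df y Uy) (dg y Uy).
exact: (esym e).
Qed.

Lemma smooth_on_sum n k (U : set 'rV[R]_n) (I : Type) (r : seq I) (P : pred I)
    (F : I -> 'rV[R]_n -> R) : open U ->
  (forall a, P a -> smooth_on k U (F a)) ->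
  smooth_on k U (fun x => \sum_(a <- r | P a) F a x).
Proof.
move=> oU sF; elim: r => [|a r IH].
  by apply: eq_smooth_on (smooth_on_cst k U 0) => // y _; rewrite big_nil.
have [Pa|nPa] := boolP (P a).
  apply: eq_smooth_on (smooth_onD oU (sF a Pa) IH) => // y _.
  by rewrite big_cons Pa.
by apply: eq_smooth_on IH => // y _; rewrite big_cons (negbTE nPa).
Qed.

(** The partial derivatives of [1/f] are those of [f] times [-(1/f)^2], so order [k] for [1/f]
    itself yields order [k+1]. *)
Lemma smooth_onV n k (U : set 'rV[R]_n) f : open U ->
  (forall y, U y -> f y != 0) -> smooth_on k U f ->
  smooth_on k U (fun x => (f x)^-1).
Proof.
move=> oU f0; elim: k f f0 => [|k IH] f f0 sf.
  case: sf => df _; split=> // y Uy.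
  by apply: differentiableV; [exact: df|exact: f0].
have [df sf'] := sf; split=> [y Uy|j].
  by apply: differentiableV; [exact: df|exact: f0].
have sV := IH f f0 (smooth_onW sf).
have sVV := smooth_onM oU (smooth_on_cst k U (-1)) (smooth_onM oU sV sV).
apply: eq_smooth_on (smooth_onM oU sVV (sf' j)) => // y Uy.
have /(congr1 (@^~ (delta_mx 0 j))) e := diffV (df y Uy) (f0 y Uy).
by rewrite mulN1r -expr2 exprVn; exact: (esym e).
Qed.

End SmoothOn.

(** * Maps into R^n and the chain rule *)

Section VectorValued.
Context {R : realType} {m n : nat}.
Implicit Types (F : 'rV[R]_m -> 'rV[R]_n) (x : 'rV[R]_m).

Lemma row_fctE F : F = \sum_(j < n) (fun x => F x 0 j *: delta_mx 0 j).
Proof.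
by apply/funext => x; rewrite fct_sumE -row_sum_delta.
Qed.

Lemma differentiable_row F x :
  (forall j, differentiable (fun y => F y 0 j) x) -> differentiable F x.
Proof.
move=> dF; rewrite (row_fctE F); apply: differentiable_sum => j.
exact: differentiableZl.
Qed.

Lemma diff_row_coord F x j v :
  differentiable F x -> 'd F x v 0 j = 'd (fun y => F y 0 j) x v.
Proof.
(* The coordinate is packed as a linear map, so that the chain rule applies and [diff_lin] computes
   its differential. *)
move=> dF; have @c : {linear 'rV[R]_n -> R}.
  by exists (fun w : 'rV[R]_n => w 0 j); do 2![eexists]; do ?[constructor];
     rewrite ?mxE// => ? *; rewrite ?mxE//; move=> ?; rewrite !mxE.
have -> : (fun y => F y 0 j) = c \o F by [].
have cc : continuous c by exact: coord_continuous.
rewrite (diff_comp dF); last exact: linear_differentiable.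
by have /(congr1 (@^~ ('d F x v))) /= -> := diff_lin (F x) cc.
Qed.

Lemma diff_delta (h : 'rV[R]_n -> R) (x v : 'rV[R]_n) :
  'd h x v = \sum_(j < n) v 0 j * partial j h x.
Proof.
rewrite {1}(row_sum_delta v) linear_sum /=; apply: eq_bigr => j _.
by rewrite linearZ.
Qed.

(** By the chain rule a partial derivative of [h \o F] is a sum of products of partials of the [F_j]
    with composites [partial j h \o F], to which the induction hypothesis applies. *)
Lemma smooth_on_comp k (U : set 'rV[R]_m) (V : set 'rV[R]_n) F h :
  open U -> (forall x, U x -> V (F x)) ->
  (forall j, smooth_on k U (fun x => F x 0 j)) -> smooth_on k V h ->
  smooth_on k U (h \o F).
Proof.
move=> oU UV; have dF k' : (forall j, smooth_on k' U (fun x => F x 0 j)) ->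
    forall x, U x -> differentiable F x.
  move=> sF x Ux; apply: differentiable_row => j.
  exact: smooth_on_differentiable (sF j) Ux.
elim: k h => [|k IH] h sF sh.
  split=> // x Ux; apply: differentiable_comp; first exact: (dF 0%N).
  exact: smooth_on_differentiable sh (UV _ Ux).
split=> [x Ux|i].
  apply: differentiable_comp; first exact: (dF k.+1).
  exact: smooth_on_differentiable sh (UV _ Ux).
apply: (@eq_smooth_on _ _ _ _
  (fun x => \sum_(j < n) partial i (fun x => F x 0 j) x * partial j h (F x))) => //.
  move=> x Ux; have dFx := dF _ sF x Ux.
  have dh := smooth_on_differentiable sh (UV _ Ux).
  rewrite /partial (diff_comp dFx dh) /= diff_delta.
  by apply: eq_bigr => j _; rewrite diff_row_coord.
apply: smooth_on_sum => // j _; apply: smooth_onM => //.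
  exact: smooth_on_partial (sF j).
by apply: IH => [j'|]; [exact: smooth_onW|exact: smooth_on_partial].
Qed.

End VectorValued.

Lemma near_openP (T : topologicalType) (x : T) (P : T -> Prop) :
  (\forall y \near x, P y) <->
  exists U : set T, [/\ open U, U x & forall y, U y -> P y].
Proof.
rewrite -[X in X <-> _]/(nbhs x P) nbhsE; split.
  by case=> U [oU Ux] UP; exists U.
by case=> U [oU Ux UP]; exists U.
Qed.

(** * Smoothness at a point *)

Section SmoothAt.
Context {R : realType} {n : nat}.
Implicit Types (f g h : 'rV[R]_n -> R) (x : 'rV[R]_n).

Lemma smooth_atP h x : smooth_at h x <->
  exists U, [/\ open U, U x & forall k, smooth_on k U h].
Proof.
split.
  move=> /near_openP [U [oU Ux UP]].
  by exists U; split=> //; apply/smooth_onP => y /UP.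
case=> U [oU Ux /smooth_onP sU]; apply/near_openP.
by exists U.
Qed.

Lemma smooth_at_near h x : smooth_at h x -> \forall y \near x, smooth_at h y.
Proof.
case/smooth_atP => U [oU Ux sU]; apply/near_openP.
by exists U; split=> // y Uy; apply/smooth_atP; exists U.
Qed.

Lemma smooth_at_differentiable h x : smooth_at h x -> differentiable h x.
Proof. by move=> /nbhs_singleton/(_ [::]). Qed.

Lemma smooth_at_continuous h x : smooth_at h x -> {for x, continuous h}.
Proof. by move/smooth_at_differentiable/differentiable_continuous. Qed.

Lemma smooth_at_partial h x j : smooth_at h x -> smooth_at (partial j h) x.
Proof.
case/smooth_atP => U [oU Ux sU]; apply/smooth_atP; exists U; split=> // k.
exact: smooth_on_partial.
Qed.

(** Finitely many neighbourhoods intersect in a neighbourhood. Sums and products of two functions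
    use it with [I := bool], maps into R^n with the coordinate indices. *)
Lemma smooth_at_common (I : finType) (F : I -> 'rV[R]_n -> R) x :
  (forall a, smooth_at (F a) x) ->
  exists U, [/\ open U, U x & forall a k, smooth_on k U (F a)].
Proof.
move=> sF; have : \forall y \near x, forall a, smooth_at (F a) y.
  have := @filter_forall _ I (fun a y => smooth_at (F a) y) (nbhs x) _.
  by apply=> a; exact: smooth_at_near.
move=> /near_openP [U [oU Ux UP]]; exists U; split=> // a k.
apply/smooth_onP: k => y /UP/(_ a); exact: nbhs_singleton.
Qed.

Lemma near_smooth_at f g x :
  (\forall y \near x, f y = g y) -> smooth_at f x -> smooth_at g x.
Proof.
move=> /near_openP [V [oV Vx VP]] /smooth_atP [U [oU Ux sU]].
apply/smooth_atP; exists (U `&` V); split; [exact: openI|by []|move=> k].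
apply: eq_smooth_on (smooth_on_sub (@subIsetl _ U V) (sU k)); first exact: openI.
by move=> y [_ /VP].
Qed.

Lemma smooth_at_cst c x : smooth_at (fun=> c) x.
Proof.
apply/smooth_atP; exists setT; split=> //; first exact: openT.
by move=> k; exact: smooth_on_cst.
Qed.

Lemma smooth_atD f g x :
  smooth_at f x -> smooth_at g x -> smooth_at (fun y => f y + g y) x.
Proof.
move=> sf sg; have [|U [oU Ux sU]] :=
  @smooth_at_common bool (fun b => if b then f else g) x; first by case.
apply/smooth_atP; exists U; split=> // k.
by apply: smooth_onD => //; [exact: (sU true)|exact: (sU false)].
Qed.

Lemma smooth_atM f g x :
  smooth_at f x -> smooth_at g x -> smooth_at (fun y => f y * g y) x.
Proof.
move=> sf sg; have [|U [oU Ux sU]] :=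
  @smooth_at_common bool (fun b => if b then f else g) x; first by case.
apply/smooth_atP; exists U; split=> // k.
by apply: smooth_onM => //; [exact: (sU true)|exact: (sU false)].
Qed.

Lemma smooth_at_sum (I : Type) (r : seq I) (P : pred I)
    (F : I -> 'rV[R]_n -> R) x :
  (forall a, P a -> smooth_at (F a) x) ->
  smooth_at (fun y => \sum_(a <- r | P a) F a y) x.
Proof.
move=> sF; elim: r => [|a r IH].
  by under eq_fun do rewrite big_nil; exact: smooth_at_cst.
under eq_fun do rewrite big_cons.
by case: (P a) (sF a) => // /(_ isT) Pa; exact: smooth_atD.
Qed.

Lemma smooth_at_prod (I : Type) (r : seq I) (P : pred I)
    (F : I -> 'rV[R]_n -> R) x :
  (forall a, P a -> smooth_at (F a) x) ->
  smooth_at (fun y => \prod_(a <- r | P a) F a y) x.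
Proof.
move=> sF; elim: r => [|a r IH].
  by under eq_fun do rewrite big_nil; exact: smooth_at_cst.
under eq_fun do rewrite big_cons.
by case: (P a) (sF a) => // /(_ isT) Pa; exact: smooth_atM.
Qed.

Lemma smooth_atV f x : smooth_at f x -> f x != 0 ->
  smooth_at (fun y => (f y)^-1) x.
Proof.
move=> sf f0; have /near_openP [V [oV Vx VP]] : \forall y \near x, f y != 0.
  exact: (cvgr_neq0 (f x) (smooth_at_continuous sf) f0).
have /smooth_atP [U [oU Ux sU]] := sf.
apply/smooth_atP; exists (U `&` V); split; [exact: openI|by []|move=> k].
apply: smooth_onV; [exact: openI|by move=> y [_ /VP]|].
exact: smooth_on_sub (@subIsetl _ U V) (sU k).
Qed.

Lemma smooth_at_det l (A : 'rV[R]_n -> 'M[R]_l) x :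
  (forall a b, smooth_at (fun y => A y a b) x) ->
  smooth_at (fun y => \det (A y)) x.
Proof.
move=> sA; apply: smooth_at_sum => s _; apply: smooth_atM.
  exact: smooth_at_cst.
exact: smooth_at_prod.
Qed.

(** Cramer's rule writes the entries as cofactors over the determinant. [invmx] obeys it only on
    invertible matrices, whence the hypothesis on a whole neighbourhood. *)
Lemma smooth_at_invmx l (A : 'rV[R]_n -> 'M[R]_l) x :
  (\forall y \near x, A y \in unitmx) ->
  (forall a b, smooth_at (fun y => A y a b) x) ->
  forall a b, smooth_at (fun y => invmx (A y) a b) x.
Proof.
move=> uA sA a b.
apply: (@near_smooth_at (fun y => (\det (A y))^-1 * cofactor (A y) b a)).
  by apply: filterS uA => y uy; rewrite /invmx uy !mxE.
apply: smooth_atM; last first.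
  apply: smooth_atM; first exact: smooth_at_cst.
  by apply: smooth_at_det => c d; under eq_fun do rewrite !mxE.
apply: smooth_atV; first exact: smooth_at_det.
by have := nbhs_singleton uA; rewrite unitmxE unitfE.
Qed.

End SmoothAt.

(** [F] is continuous at [x], so the neighbourhood can be shrunk until [F] maps it into one where
    [h] is smooth. *)
Lemma smooth_at_comp (R : realType) m n (F : 'rV[R]_m -> 'rV[R]_n) h x :
  (forall j, smooth_at (fun y => F y 0 j) x) -> smooth_at h (F x) ->
  smooth_at (h \o F) x.
Proof.
move=> sF sh; have [U [oU Ux sU]] := smooth_at_common sF.
have cF : {for x, continuous F}.
  apply/differentiable_continuous/differentiable_row => j.
  exact: smooth_at_differentiable.
have /smooth_atP [V [oV VF sV]] := sh.
have /cF : nbhs (F x) V by exact: open_nbhs_nbhs.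
rewrite nbhs_simpl /= nbhsE => -[V' [oV' V'x] V'V].
apply/smooth_atP; exists (U `&` V'); split; [exact: openI|by []|move=> k].
apply: (@smooth_on_comp _ _ _ _ _ V) => //; first exact: openI.
- by move=> y [_ /V'V].
- by move=> j; apply: smooth_on_sub (@subIsetl _ U V') (sU j k).
Qed.

(** * Smooth fields on manifolds *)

Section BilinearForm.
Context {R : realType} {n : nat}.

Lemma form_addl (B : 'M[R]_n) (u v w : 'rV[R]_n) :
  form B (u + v) w = form B u w + form B v w.
Proof. by rewrite /form !mulmxDl mxE. Qed.

Lemma form_oppl (B : 'M[R]_n) (u w : 'rV[R]_n) : form B (- u) w = - form B u w.
Proof. by rewrite /form !mulNmx mxE. Qed.

Lemma form_0l (B : 'M[R]_n) (w : 'rV[R]_n) : form B 0 w = 0.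
Proof. by rewrite /form !mul0mx mxE. Qed.

Lemma form_0r (B : 'M[R]_n) (w : 'rV[R]_n) : form B w 0 = 0.
Proof. by rewrite /form trmx0 mulmx0 mxE. Qed.

Lemma form_suml (B : 'M[R]_n) (I : Type) (s : seq I) (u : I -> 'rV[R]_n) w :
  form B (\sum_(a <- s) u a) w = \sum_(a <- s) form B (u a) w.
Proof. by rewrite /form !mulmx_suml summxE. Qed.

Lemma form_sumr (B : 'M[R]_n) (I : Type) (s : seq I) (u : I -> 'rV[R]_n) w :
  form B w (\sum_(a <- s) u a) = \sum_(a <- s) form B w (u a).
Proof. by rewrite /form linear_sum mulmx_sumr summxE. Qed.

Lemma form_scalel (B : 'M[R]_n) a (u w : 'rV[R]_n) :
  form B (a *: u) w = a * form B u w.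
Proof. by rewrite /form -!scalemxAl mxE. Qed.

Lemma form_scaler (B : 'M[R]_n) a (u w : 'rV[R]_n) :
  form B u (a *: w) = a * form B u w.
Proof. by rewrite /form linearZ -scalemxAr mxE. Qed.

End BilinearForm.

(** * Charts and changes of charts *)

Section Charts.
Context {R : realType} {n : nat} (M : manifold R n).
Implicit Types (p q r : M) (f g : M -> R) (v w : 'rV[R]_n).

Lemma chart_dom_near p q : chart_dom p q -> \forall r \near q, chart_dom p r.
Proof. by move=> pq; apply: open_nbhs_nbhs; split=> //; exact: chart_dom_open. Qed.

Lemma chart_inv_near p q (P : M -> Prop) : chart_dom p q ->
  (\forall r \near q, P r) -> \forall x \near chart p q, P (chart_inv p x).
Proof.
move=> pq nP.
have : chart_inv p @ chart p q --> chart_inv p (chart p q).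
  exact: chart_inv_continuous.
by rewrite chartK //; apply.
Qed.

Lemma chart_near p q (P : 'rV[R]_n -> Prop) : chart_dom p q ->
  (\forall x \near chart p q, P x) -> \forall r \near q, P (chart p r).
Proof. by move=> pq nP; exact: (chart_continuous pq nP). Qed.

Lemma chart_invK_near p q : chart_dom p q ->
  \forall x \near chart p q, chart p (chart_inv p x) = x.
Proof.
move=> pq; have : nbhs (chart p q) (chart p @` chart_dom p).
  by apply: open_nbhs_nbhs; split; [exact: chart_img_open|exists q].
by apply: filterS => x [r pr <-]; rewrite chartK.
Qed.

Lemma near_smooth_fun_at f g p : (\forall q \near p, f q = g q) ->
  smooth_fun_at f p -> smooth_fun_at g p.
Proof.
move=> fg; apply: near_smooth_at.
exact: (chart_inv_near (chart_dom_mem p) fg).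
Qed.

Lemma smooth_fun_atD f g p : smooth_fun_at f p -> smooth_fun_at g p ->
  smooth_fun_at (fun q => f q + g q) p.
Proof. exact: smooth_atD. Qed.

Lemma smooth_fun_atM f g p : smooth_fun_at f p -> smooth_fun_at g p ->
  smooth_fun_at (fun q => f q * g q) p.
Proof. exact: smooth_atM. Qed.

Lemma smooth_fun_at_cst (c : R) p : smooth_fun_at (fun _ : M => c) p.
Proof. exact: smooth_at_cst. Qed.

Lemma smooth_fun_at_sum (I : Type) (s : seq I) (P : pred I) (F : I -> M -> R) p :
  (forall a, P a -> smooth_fun_at (F a) p) ->
  smooth_fun_at (fun q => \sum_(a <- s | P a) F a q) p.
Proof. exact: smooth_at_sum. Qed.

Lemma smooth_fun_at_chart p q (j : 'I_n) : chart_dom p q ->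
  smooth_fun_at (fun r => chart p r 0 j) q.
Proof. by move=> pq; apply: chart_smooth => //; exact: chart_dom_mem. Qed.

Lemma smooth_fun_at_in_chart p (h : 'rV[R]_n -> R) :
  smooth_at h (chart p p) -> smooth_fun_at (fun q => h (chart p q)) p.
Proof.
apply: near_smooth_at; apply: filterS (chart_invK_near (chart_dom_mem p)).
by move=> x /= ->.
Qed.

Lemma dirD p v w f : dir p (v + w) f = dir p v f + dir p w f.
Proof. exact: linearD. Qed.

Lemma dirZ p (a : R) v f : dir p (a *: v) f = a * dir p v f.
Proof. exact: linearZ. Qed.

(* [coords p q v] are the components in [chart p] of the vector [v] of T_q M,
   which itself is given in [chart q]; [frame p q] is the inverse map. *)
Definition coords p q v : 'rV[R]_n :=
  \row_j dir q v (fun r => chart p r 0 j).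

Definition frame p q v : 'rV[R]_n :=
  'd (fun x => chart q (chart_inv p x)) (chart p q) v.

Lemma differentiable_transition p q r : chart_dom p r -> chart_dom q r ->
  differentiable (fun x => chart q (chart_inv p x)) (chart p r).
Proof.
move=> pr qr; apply: differentiable_row => j.
by apply: smooth_at_differentiable; exact: chart_smooth.
Qed.

Lemma coordsE p q v : chart_dom p q ->
  coords p q v = 'd (fun x => chart p (chart_inv q x)) (chart q q) v.
Proof.
move=> pq; apply/rowP => j; rewrite mxE diff_row_coord //.
by apply: differentiable_transition => //; exact: chart_dom_mem.
Qed.

(** The two transition maps are mutually inverse near the point, so the chain rule multiplies their
    differentials to that of the identity. *)
Lemma diff_transitionK p q r v : chart_dom p r -> chart_dom q r ->
  'd (fun x => chart p (chart_inv q x)) (chart q r)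
     ('d (fun x => chart q (chart_inv p x)) (chart p r) v) = v.
Proof.
move=> pr qr; have dpq := differentiable_transition pr qr.
have dqp : differentiable (fun x => chart p (chart_inv q x))
    (chart q (chart_inv p (chart p r))).
  by rewrite chartK //; exact: differentiable_transition.
have := diff_comp dpq dqp; rewrite /= chartK // => /(congr1 (@^~ v)) /= <-.
rewrite (@near_eq_diff _ _ _ id) ?diff_val //.
have nq := chart_inv_near pr (chart_dom_near qr).
by apply: filterS2 nq (chart_invK_near pr) => x /= qx xE; rewrite chartK.
Qed.

Lemma coords_frame p q v : chart_dom p q -> coords p q (frame p q v) = v.
Proof.
by move=> pq; rewrite coordsE // diff_transitionK //; exact: chart_dom_mem.
Qed.

Lemma frame_coords p q v : chart_dom p q -> frame p q (coords p q v) = v.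
Proof.
by move=> pq; rewrite coordsE // /frame diff_transitionK //; exact: chart_dom_mem.
Qed.

Lemma frame_sum p q v :
  frame p q v = \sum_(j < n) v 0 j *: frame p q (delta_mx 0 j).
Proof.
rewrite {1}(row_sum_delta v) /frame linear_sum /=; apply: eq_bigr => j _.
by rewrite linearZ.
Qed.

(** These are the constant-coefficient fields of [chart p]: near [p] their components in that chart
    are the entries of [v]. *)
Lemma smooth_vf_frame p v : smooth_vf_at (fun q : M => frame p q v) p.
Proof.
move=> j; apply: near_smooth_fun_at (smooth_fun_at_cst (v 0 j) p).
apply: filterS (chart_dom_near (chart_dom_mem p)) => q pq.
by rewrite -[in LHS](coords_frame v pq) mxE.
Qed.

End Charts.

(** * Smooth maps and their differentials *)

Section Maps.
Context {R : realType} {m n : nat} (M : manifold R m) (N : manifold R n).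
Variable F : M -> N.
Implicit Types (p q : M) (r : N) (f : N -> R) (V W : M -> 'rV[R]_n).

(** The target chart is any [chart r] whose domain contains [F p]. Taking [r] to be [F p] leads to
    [tmap], and taking [F] to be the identity leads to the change of chart [dir_coords]. *)
Lemma dir_chain r p v f : {for p, continuous F} -> chart_dom r (F p) ->
  (forall j : 'I_n, smooth_fun_at (fun q => chart r (F q) 0 j) p) ->
  differentiable (f \o chart_inv r) (chart r (F p)) ->
  dir p v (f \o F) = 'd (f \o chart_inv r) (chart r (F p))
    (\row_j dir p v (fun q => chart r (F q) 0 j)).
Proof.
move=> cF rFp sF df; pose G x := chart r (F (chart_inv p x)).
have dG : differentiable G (chart p p).
  by apply: differentiable_row => j; exact: smooth_at_differentiable (sF j).
have Gp : G (chart p p) = chart r (F p).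
  by rewrite /G chartK //; exact: chart_dom_mem.
have df' : differentiable (f \o chart_inv r) (G (chart p p)) by rewrite Gp.
have -> : (\row_j dir p v (fun q => chart r (F q) 0 j)) = 'd G (chart p p) v.
  by apply/rowP => j; rewrite mxE diff_row_coord.
have /(congr1 (@^~ v)) /= := diff_comp dG df'; rewrite Gp => <-.
rewrite /dir (near_eq_diff _ (differentiable_comp dG df')) //.
have nF : \forall q \near p, chart_dom r (F q) by exact: (cF _ (chart_dom_near rFp)).
apply: filterS (chart_inv_near (chart_dom_mem p) nF) => x rx.
by rewrite /= chartK.
Qed.

Hypothesis sF : smooth_map F.

Lemma smooth_map_near p (P : N -> Prop) :
  (\forall r \near F p, P r) -> \forall q \near p, P (F q).
Proof. by move=> nP; exact: (sF.1 p _ nP). Qed.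

Lemma smooth_fun_at_comp f p : smooth_fun_at f (F p) -> smooth_fun_at (f \o F) p.
Proof.
move=> sf; pose G x := chart (F p) (F (chart_inv p x)).
have Gp : G (chart p p) = chart (F p) (F p).
  by rewrite /G chartK //; exact: chart_dom_mem.
apply: (@near_smooth_at _ _ ((f \o chart_inv (F p)) \o G)).
  have nF : \forall q \near p, chart_dom (F p) (F q).
    exact: (smooth_map_near (chart_dom_near (chart_dom_mem (F p)))).
  apply: filterS (chart_inv_near (chart_dom_mem p) nF) => x rx.
  by rewrite /= chartK.
by apply: smooth_at_comp => [j|]; [exact: sF.2|rewrite Gp].
Qed.

Lemma smooth_fun_at_map r p (j : 'I_n) : chart_dom r (F p) ->
  smooth_fun_at (fun q => chart r (F q) 0 j) p.
Proof.
move=> rFp.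
exact: (smooth_fun_at_comp (f := fun s => chart r s 0 j)
  (smooth_fun_at_chart j rFp)).
Qed.

Lemma dir_tmap p v f : smooth_fun_at f (F p) ->
  dir (F p) (tmap F p v) f = dir p v (f \o F).
Proof.
move=> sf; have dm := chart_dom_mem (F p).
rewrite (dir_chain v (sF.1 p) dm); first last.
- exact: smooth_at_differentiable.
- by move=> j; exact: smooth_fun_at_map.
rewrite /dir; congr ('d _ _ _); apply/rowP => j; rewrite mxE /tmap diff_row_coord //.
by apply: differentiable_row => k; apply: smooth_at_differentiable; exact: sF.2.
Qed.

End Maps.

Section VectorFields.
Context {R : realType} {n : nat} (M : manifold R n).

Lemma dir_coords (p q : M) v (f : M -> R) : chart_dom p q ->
  differentiable (f \o chart_inv p) (chart p q) ->
  dir q v f = 'd (f \o chart_inv p) (chart p q) (coords p q v).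
Proof.
move=> pq df; rewrite -(@dir_chain _ _ _ _ _ id p q v f) // => j.
exact: smooth_fun_at_chart.
Qed.

(** [dir q] is computed in [chart q], which varies with [q] without any regularity. Rewriting
    everything near [p] in the single [chart p] gives a sum of components of [X] times partials of
    [f]. *)
Lemma smooth_dir (p : M) X (f : M -> R):
  smooth_vf_at X p -> smooth_fun_at f p ->
  smooth_fun_at (fun q => dir q (X q) f) p.
Proof.
move=> sX sf; have dm := chart_dom_mem p.
apply: (@near_smooth_fun_at _ _ _ (fun q => \sum_(j < n)
   dir q (X q) (fun r => chart p r 0 j) * partial j (f \o chart_inv p) (chart p q))).
  apply: filterS2 (chart_dom_near dm) (chart_near dm (smooth_at_near sf)).
  move=> q pq sfq; rewrite (dir_coords _ pq (smooth_at_differentiable sfq)).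
  by rewrite [RHS]diff_delta; apply: eq_bigr => j _; rewrite mxE.
apply: smooth_fun_at_sum => j _; apply: smooth_fun_atM; first exact: sX.
by apply: smooth_fun_at_in_chart; exact: smooth_at_partial.
Qed.

End VectorFields.

Section FieldsAlong.
Context {R : realType} {m n : nat} (M : manifold R m) (N : manifold R n).
Variable F : M -> N.
Implicit Types (p q : M) (V W : M -> 'rV[R]_n).

Lemma smooth_alongD V W p : smooth_along_at F V p -> smooth_along_at F W p ->
  smooth_along_at F (fun q => V q + W q) p.
Proof.
by move=> sV sW j; under eq_fun do rewrite dirD; exact: smooth_fun_atD.
Qed.

Lemma smooth_alongZ (f : M -> R) V p : smooth_fun_at f p ->
  smooth_along_at F V p -> smooth_along_at F (fun q => f q *: V q) p.
Proof.
by move=> sf sV j; under eq_fun do rewrite dirZ; exact: smooth_fun_atM.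
Qed.

Lemma smooth_along0 p : smooth_along_at F (fun=> 0) p.
Proof.
move=> j; under eq_fun do rewrite /dir linear0.
exact: smooth_fun_at_cst.
Qed.

Hypothesis sF : smooth_map F.

Lemma smooth_along_comp (Y : N -> 'rV[R]_n) p :
  smooth_vf_at Y (F p) -> smooth_along_at F (Y \o F) p.
Proof. by move=> sY j; exact: (smooth_fun_at_comp sF (sY j)). Qed.

(** The components of the image field in [chart (F p)] are the derivatives along [X] of the
    coordinates of [F]. *)
Lemma smooth_along_tmap (X : M -> 'rV[R]_m) p : smooth_vf_at X p ->
  smooth_along_at F (fun q => tmap F q (X q)) p.
Proof.
move=> sX j; have dm := chart_dom_mem (F p).
apply: near_smooth_fun_at (smooth_dir sX (smooth_fun_at_map sF j dm)).
apply: filterS (smooth_map_near sF (chart_dom_near dm)) => q rq.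
by rewrite dir_tmap //; exact: smooth_fun_at_chart.
Qed.

(** [smooth_tensor2] tests [B] on vector fields of [N], whereas [V] and [W] live only along [F].
    They are therefore expanded in the coordinate frame [e] of [N], whose coefficients under [B] are
    smooth near [F p]. *)
Lemma smooth_form B V W p : smooth_tensor2 B ->
  smooth_along_at F V p -> smooth_along_at F W p ->
  smooth_fun_at (fun q => form (B (F q)) (V q) (W q)) p.
Proof.
move=> sB sV sW; have dm := chart_dom_mem (F p).
pose e a (r : N) := frame (F p) r (delta_mx 0 a).
pose c (X : M -> 'rV[R]_n) a q :=
  dir (F q) (X q) (fun r => chart (F p) r 0 a).
apply: (@near_smooth_fun_at _ _ _ (fun q => \sum_(a < n) \sum_(b < n)
    c V a q * (c W b q * ((fun r => form (B r) (e a r) (e b r)) \o F) q))).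
  apply: filterS (smooth_map_near sF (chart_dom_near dm)) => q rq.
  rewrite -[in RHS](frame_coords (V q) rq) -[in RHS](frame_coords (W q) rq).
  rewrite (frame_sum _ _ (coords _ _ (V q))) (frame_sum _ _ (coords _ _ (W q))).
  rewrite form_suml; apply: eq_bigr => a _.
  rewrite form_sumr; apply: eq_bigr => b _.
  by rewrite form_scalel form_scaler !mxE.
apply: smooth_fun_at_sum => a _; apply: smooth_fun_at_sum => b _.
apply: smooth_fun_atM; first exact: sV.
apply: smooth_fun_atM; first exact: sW.
apply: smooth_fun_at_comp => //; apply: sB; exact: smooth_vf_frame.
Qed.

End FieldsAlong.

(** * Existence and smoothness of tangential parts *)

Section TangentialPart.
Context {R : realType} {m n : nat} (M : manifold R m) (N : manifold R n).
Variables (F : M -> N) (B : N -> 'M[R]_n).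
Hypothesis (sF : smooth_map F) (sB : smooth_tensor2 B).
Hypothesis B_nondeg : forall p t,
  (forall u, form (B (F p)) (tmap F p t) (tmap F p u) = 0) -> t = 0.

Lemma tmap_sum p (I : Type) (s : seq I) (u : I -> 'rV[R]_m) :
  tmap F p (\sum_(a <- s) u a) = \sum_(a <- s) tmap F p (u a).
Proof. exact: linear_sum. Qed.

Lemma tmapZ p a (u : 'rV[R]_m) : tmap F p (a *: u) = a *: tmap F p u.
Proof. exact: linearZ. Qed.

Lemma tmapD p (u v : 'rV[R]_m) : tmap F p (u + v) = tmap F p u + tmap F p v.
Proof. exact: linearD. Qed.

Lemma smooth_tangential W (t : M -> 'rV[R]_m) p :
  (forall q u, form (B (F q)) (W q - tmap F q (t q)) (tmap F q u) = 0) ->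
  smooth_along_at F W p -> smooth_vf_at t p.
Proof.
move=> tP sW; have dm := chart_dom_mem p.
pose e k (q : M) := tmap F q (frame p q (delta_mx 0 k)).
pose G q : 'M[R]_m := \matrix_(k, l) form (B (F q)) (e k q) (e l q).
pose b q : 'rV[R]_m := \row_l form (B (F q)) (W q) (e l q).
have frE q u : tmap F q (frame p q u) = \sum_(k < m) u 0 k *: e k q.
  by rewrite frame_sum tmap_sum; apply: eq_bigr => k _; rewrite tmapZ.
have GE q u l : (u *m G q) 0 l = form (B (F q)) (tmap F q (frame p q u)) (e l q).
  rewrite frE form_suml mxE; apply: eq_bigr => k _.
  by rewrite form_scalel mxE.
(* A row in the left kernel of the Gram matrix represents a tangent vector orthogonal to the whole
   tangent space, hence zero by nondegeneracy. *)
have uG q : chart_dom p q -> G q \in unitmx.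
  move=> pq; rewrite -row_free_unit; apply/inj_row_free => u uG0.
  rewrite -(coords_frame u pq).
  suff -> : frame p q u = 0.
    by apply/rowP => j; rewrite !mxE /dir linear0.
  apply: (B_nondeg (p := q)) => v; rewrite -(frame_coords v pq).
  rewrite (frE _ (coords p q v)) form_sumr.
  by rewrite big1 // => l _; rewrite form_scaler -GE uG0 [X in _ * X]mxE mulr0.
(* Orthogonality of [W - dF(t)] to the frame is the linear system with matrix [G] and right-hand
   side [b]. *)
have cE q : chart_dom p q -> coords p q (t q) = b q *m invmx (G q).
  move=> pq; rewrite -[LHS](mulmxK (uG q pq)); congr (_ *m _).
  apply/rowP => l; rewrite GE frame_coords // mxE.
  apply/esym/subr0_eq; rewrite -[RHS](tP q (frame p q (delta_mx 0 l))) /e.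
  by rewrite /form !mulmxBl !mxE.
have se k : smooth_along_at F (e k) p.
  by apply: smooth_along_tmap => //; exact: smooth_vf_frame.
move=> j; apply: (@near_smooth_fun_at _ _ _ (fun q =>
    \sum_(l < m) b q 0 l * invmx (G q) l j)).
  apply: filterS (chart_dom_near dm) => q pq.
  by have /rowP/(_ j) := cE q pq; rewrite !mxE => ->.
apply: smooth_fun_at_sum => l _; apply: smooth_fun_atM.
  under eq_fun do rewrite mxE.
  exact: (smooth_form sF sB sW (se l)).
apply: smooth_at_invmx => [|k k'].
  apply: (chart_inv_near (P := fun q => G q \in unitmx) dm).
  by apply: filterS (chart_dom_near dm) => q /uG.
by under eq_fun do rewrite mxE; exact: (smooth_form sF sB (se k) (se k')).
Qed.

(** The same Gram system is solved at one point, in the standard basis of T_p M. *)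
Lemma tangential_exists p (w : 'rV[R]_n) :
  exists t, forall u, form (B (F p)) (w - tmap F p t) (tmap F p u) = 0.
Proof.
pose e k := tmap F p (delta_mx 0 k).
pose G : 'M[R]_m := \matrix_(k, l) form (B (F p)) (e k) (e l).
have tE u : tmap F p u = \sum_(k < m) u 0 k *: e k.
  rewrite {1}(row_sum_delta u) tmap_sum; apply: eq_bigr => k _.
  by rewrite tmapZ.
have GE u l : (u *m G) 0 l = form (B (F p)) (tmap F p u) (e l).
  by rewrite tE form_suml mxE; apply: eq_bigr => k _; rewrite form_scalel mxE.
have uG : G \in unitmx.
  rewrite -row_free_unit; apply/inj_row_free => u uG0.
  apply: (B_nondeg (p := p)) => v; rewrite (tE v) form_sumr.
  by rewrite big1 // => l _; rewrite form_scaler -GE uG0 [X in _ * X]mxE mulr0.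
pose b : 'rV[R]_m := \row_l form (B (F p)) w (e l).
exists (b *m invmx G) => u; rewrite (tE u) form_sumr big1 // => l _.
rewrite form_scaler; have -> : form (B (F p)) (w - tmap F p (b *m invmx G)) (e l) =
    b 0 l - (b *m invmx G *m G) 0 l.
  by rewrite GE mxE /form !mulmxBl !mxE.
by rewrite mulmxKV // subrr mulr0.
Qed.

End TangentialPart.

(** * Lorentzian forms *)

Section LorentzianForm.
Context {R : realType}.

Definition lorentz_diag n : 'M[R]_n :=
  diag_mx (\row_(j < n) if j == 0%N :> nat then -1 else 1).

Lemma form_lorentz_diag n (u v : 'rV[R]_n.+1) :
  form (lorentz_diag n.+1) u v =
  - (u 0 0 * v 0 0) + \sum_(j < n) u 0 (lift ord0 j) * v 0 (lift ord0 j).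
Proof.
rewrite /form mul_mx_diag mxE big_ord_recl !mxE /= mulrN1 mulNr; congr (_ + _).
by apply: eq_bigr => j _; rewrite !mxE /= mulr1.
Qed.

(* With [x] timelike, [x.x = -1], and [v] null and orthogonal to [x],
   [\sum_(j > 0) (v_0 x_j - x_0 v_j)^2 = - v_0^2]. *)
Lemma lorentz_diag_null_orthogonal n (x v : 'rV[R]_n.+1) :
  form (lorentz_diag n.+1) x x = -1 -> form (lorentz_diag n.+1) v x = 0 ->
  form (lorentz_diag n.+1) v v = 0 -> v = 0.
Proof.
rewrite !form_lorentz_diag => xx vx vv.
have sq : \sum_(j < n) (v 0 0 * x 0 (lift ord0 j) - x 0 0 * v 0 (lift ord0 j)) ^+ 2
    = - (v 0 0) ^+ 2.
  transitivity ((v 0 0) ^+ 2 * (\sum_(j < n) x 0 (lift ord0 j) * x 0 (lift ord0 j))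
    - 2 * v 0 0 * x 0 0 * (\sum_(j < n) v 0 (lift ord0 j) * x 0 (lift ord0 j))
    + (x 0 0) ^+ 2 * (\sum_(j < n) v 0 (lift ord0 j) * v 0 (lift ord0 j))).
    rewrite !mulr_sumr -sumrB -big_split /=; apply: eq_bigr => j _; ring.
  move/eqP: xx; rewrite addrC subr_eq => /eqP ->.
  move/eqP: vx; rewrite addrC subr_eq => /eqP ->.
  move/eqP: vv; rewrite addrC subr_eq => /eqP ->.
  ring.
have v0 : v 0 0 = 0.
  apply/eqP; rewrite -sqrf_eq0 eq_le sqr_ge0 andbT -oppr_ge0 -sq.
  by apply: sumr_ge0 => j _; exact: sqr_ge0.
(* Once the time component vanishes, nullity of [v] says that a sum of squares is zero. *)
move: vv; rewrite v0 mulr0 oppr0 add0r => /eqP.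
rewrite psumr_eq0 => [/allP vj|j _]; last by rewrite -expr2 sqr_ge0.
apply/rowP => k; rewrite mxE; have [j ->|->//] := unliftP ord0 k.
by apply/eqP; have := vj j (mem_index_enum j); rewrite -expr2 sqrf_eq0.
Qed.

(** The substitution [u *m invmx P] carries [A] to the diagonal form, where the previous lemma
    applies. *)
Lemma lorentz_null_orthogonal n (A : 'M[R]_n) (x v : 'rV[R]_n) :
  (exists P : 'M[R]_n, P \in unitmx /\ P *m A *m P^T = lorentz_diag n) ->
  form A x x = -1 -> form A v x = 0 -> form A v v = 0 -> v = 0.
Proof.
case: n A x v => [|n] A x v; first by move=> *; rewrite [v]thinmx0.
case=> P [uP PA]; have fE u w : form A u w =
    form (lorentz_diag n.+1) (u *m invmx P) (w *m invmx P).
  rewrite -PA /form trmx_mul !mulmxA mulmxKV //.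
  by rewrite -[u *m A *m _ *m _]mulmxA -trmx_mul mulVmx // trmx1 mulmx1.
rewrite !fE => xx vx vv.
rewrite -[v](mulmxKV uP).
by rewrite (lorentz_diag_null_orthogonal xx vx vv) mul0mx.
Qed.

End LorentzianForm.

(** * The second fundamental form *)

Section TotallyGeodesic.
Context {R : realType} {n m : nat} (N : LCS_manifold R n) (M : manifold R m).
Variables (i : M -> N) (D : M -> 'rV[R]_m -> (M -> 'rV[R]_n) -> 'rV[R]_n).
Hypothesis imm : immersion i.
Hypothesis pbD : pullback_connection i (@nabla R n N) D.
Hypothesis inv : invariant_sub i.
Hypothesis alpha1 : forall q : N, alpha q <> 1%R.
Implicit Types (p q : M) (X Y Z : M -> 'rV[R]_m) (V W : M -> 'rV[R]_n).

Local Notation g p := (metric (i p)).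
Local Notation xi_along p := (@xi R n N (i p)).

(** The image of [t] is orthogonal to every tangent vector, in particular to itself and to [xi],
    which invariance makes tangent. A null vector orthogonal to a timelike one is zero, and the
    immersion is injective on T_p M. *)
Lemma metric_tangent_nondegenerate p t :
  (forall u, form (g p) (tmap i p t) (tmap i p u) = 0) -> t = 0.
Proof.
move=> t0; have [x xE] := inv.1 p; apply: (imm.2 p).
rewrite [RHS]linear0.
apply: (lorentz_null_orthogonal ((metric_lorentzian N).2 (i p)) (xi_unit (i p))).
  by rewrite -xE t0.
exact: t0.
Qed.

Lemma tan_partP p w u :
  form (g p) (w - tmap i p (tan_part i p w)) (tmap i p u) = 0.
Proof.
have := tangential_exists metric_tangent_nondegenerate p w.
(* Existence of a tangential part excludes the default value [0] of [xget]. *)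
case/cid => t tP; rewrite /tan_part; case: xgetP => [t' _|/(_ t)]; first exact.
by move/(_ tP).
Qed.

Lemma tan_part_unique p w t :
  (forall u, form (g p) (w - tmap i p t) (tmap i p u) = 0) -> tan_part i p w = t.
Proof.
move=> tP; apply/subr0_eq/(@metric_tangent_nondegenerate p) => u.
have -> : tmap i p (tan_part i p w - t) =
    (w - tmap i p t) - (w - tmap i p (tan_part i p w)).
  by rewrite [LHS]linearB opprB [RHS]addrC addrA subrK.
by rewrite form_addl form_oppl tP tan_partP subrr.
Qed.

Lemma tan_partD p v w :
  tan_part i p (v + w) = tan_part i p v + tan_part i p w.
Proof.
apply: tan_part_unique => u.
by rewrite tmapD opprD addrACA form_addl !tan_partP addr0.
Qed.

Lemma tan_partZ p a v : tan_part i p (a *: v) = a *: tan_part i p v.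
Proof.
apply: tan_part_unique => u.
by rewrite tmapZ -scalerBr form_scalel tan_partP mulr0.
Qed.

Lemma tan_part_tmap p t : tan_part i p (tmap i p t) = t.
Proof. by apply: tan_part_unique => u; rewrite subrr form_0l. Qed.

Lemma nor_partD p v w :
  nor_part i p (v + w) = nor_part i p v + nor_part i p w.
Proof. by rewrite /nor_part tan_partD tmapD opprD addrACA. Qed.

Lemma nor_partZ p a v : nor_part i p (a *: v) = a *: nor_part i p v.
Proof. by rewrite /nor_part tan_partZ tmapZ scalerBr. Qed.

Lemma nor_part_tmap p t : nor_part i p (tmap i p t) = 0.
Proof. by rewrite /nor_part tan_part_tmap subrr. Qed.

Lemma nor_part0 p : nor_part i p 0 = 0.
Proof. by rewrite -[X in nor_part i p X](scale0r 0) nor_partZ scale0r. Qed.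

Lemma smooth_tan_part V p : smooth_along_at i V p ->
  smooth_vf_at (fun q => tan_part i q (V q)) p.
Proof.
move=> sV; apply: (smooth_tangential imm.1 (metric_lorentzian N).1) sV.
  exact: metric_tangent_nondegenerate.
by move=> q u; exact: tan_partP.
Qed.

(** [xi] regarded as a field on M. Invariance only asserts pointwise preimages; selecting them by
    [tan_part] makes the choice smooth. *)
Definition xi_sub p : 'rV[R]_m := tan_part i p (xi_along p).

Lemma tmap_xi_sub p : tmap i p (xi_sub p) = xi_along p.
Proof. by rewrite /xi_sub; have [t <-] := inv.1 p; rewrite tan_part_tmap. Qed.

Lemma smooth_along_xi p : smooth_along_at i (fun q => xi_along q) p.
Proof. by apply: (smooth_along_comp imm.1); exact: xi_smooth. Qed.

Lemma smooth_xi_sub : smooth_vf xi_sub.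
Proof. by move=> p; apply: smooth_tan_part; exact: smooth_along_xi. Qed.

Lemma smooth_along_pushf X p : smooth_vf_at X p -> smooth_along_at i (pushf i X) p.
Proof. exact: (smooth_along_tmap imm.1). Qed.

Lemma pushf_xi_sub : pushf i xi_sub = fun p => xi_along p.
Proof. by apply/funext => p; exact: tmap_xi_sub. Qed.

Lemma pushf0 : pushf i (fun=> 0) = fun=> 0.
Proof. by apply/funext => p; rewrite /pushf /tmap linear0. Qed.

Lemma connection0 p v : D p v (fun=> 0) = 0.
Proof.
have s0 := smooth_along0 i p.
have := conn_leibniz pbD.1 v (smooth_fun_at_cst 0 p) s0.
under eq_fun do rewrite scaler0.
by rewrite scaler0 scale0r addr0.
Qed.

Lemma sigma0 X p : sigma i D X (fun=> 0) p = 0.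
Proof. by rewrite /sigma pushf0 connection0 nor_part0. Qed.

Lemma qsm0 p v : qsm i D p v (fun=> 0) = 0.
Proof.
by rewrite /qsm connection0 /eta form_0l form_0r !scale0r addr0 subr0.
Qed.

Lemma qsm_nor0 X p : qsm_nor i D X (fun=> 0) p = 0.
Proof. by rewrite /qsm_nor qsm0 nor_part0. Qed.

Lemma qsm_tan0 X p : qsm_tan i D X (fun=> 0) p = 0.
Proof.
rewrite /qsm_tan pushf0 qsm0 -[X in tan_part i p X](scale0r 0) tan_partZ.
exact: scale0r.
Qed.

(** The converse implication needs this: [totally_geodesic] speaks only of smooth fields, and the
    covariant derivatives evaluate [sigma] on fields of this kind. *)
Lemma smooth_qsm_tan X Y : smooth_vf X -> smooth_vf Y -> smooth_vf (qsm_tan i D X Y).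
Proof.
move=> sX sY p; apply: smooth_tan_part.
have sY' := smooth_along_pushf (sY p).
have sX' := smooth_along_pushf (sX p).
have sxi := smooth_along_xi p.
have sg V W : smooth_along_at i V p -> smooth_along_at i W p ->
    smooth_fun_at (fun q => form (g q) (V q) (W q)) p.
  exact: (smooth_form imm.1 (metric_lorentzian N).1).
have sphi : smooth_along_at i (fun q => phi (i q) (tmap i q (X q))) p.
  by apply: smooth_alongD => //; apply: smooth_alongZ => //; exact: sg.
(* The subtracted term becomes an added multiple of [xi], as the closure lemmas require. *)
rewrite /qsm; under eq_fun do rewrite -scaleNr -mulN1r.
apply: smooth_alongD; first apply: smooth_alongD.
- exact: (conn_smooth pbD.1 (sX p) sY').
- by apply: smooth_alongZ => //; exact: sg.
- apply: smooth_alongZ => //; apply: smooth_fun_atM; first exact: smooth_fun_at_cst.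
  exact: sg.
Qed.

(* The derivative of [xi] along [M] is [alpha * phi], which is tangent. *)
Lemma sigma_xi X p : sigma i D X xi_sub p = 0.
Proof.
rewrite /sigma pushf_xi_sub.
have -> : D p (X p) (fun q => xi_along q) =
    @nabla R n N (i p) (tmap i p (X p)) (@xi R n N).
  by apply: pbD.2; exact: xi_smooth.
rewrite nabla_xi -tmap_xi_sub -tmapZ -tmapD -tmapZ.
exact: nor_part_tmap.
Qed.

(** Since eta(xi) = -1, the first extra term is -phi X; the second vanishes because g(phi X, xi) =
    eta(X) - eta(X) = 0. Subtracting phi X from alpha phi X leaves the factor alpha - 1. *)
Lemma qsm_tan_xi X p : qsm_tan i D X xi_sub p =
  (alpha (i p) - 1) *: (X p + eta (i p) (tmap i p (X p)) *: xi_sub p).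
Proof.
rewrite /qsm_tan /qsm pushf_xi_sub.
have -> : D p (X p) (fun q => xi_along q) =
    @nabla R n N (i p) (tmap i p (X p)) (@xi R n N).
  by apply: pbD.2; exact: xi_smooth.
rewrite nabla_xi /phi /eta xi_unit form_addl form_scalel xi_unit.
rewrite mulrN1 subrr scale0r subr0.
rewrite -scalerDl -{2}tmap_xi_sub -tmapZ -tmapD tan_partZ.
by rewrite tan_part_tmap.
Qed.

Lemma qsm_tan_xi_xi : qsm_tan i D xi_sub xi_sub = fun=> 0.
Proof.
apply/funext => p; rewrite qsm_tan_xi tmap_xi_sub /eta xi_unit scaleN1r subrr.
exact: scaler0.
Qed.

(** This combines tensoriality in the differentiated argument with sigma(Y, xi) = 0: the Leibniz
    terms that differentiate [f] and eta(X) are multiples of tangent vectors, so the normal part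
    removes them. *)
Lemma sigmaS X Y p (f : M -> R) : smooth_vf X -> smooth_fun f ->
  sigma i D Y (fun q => f q *: (X q + eta (i q) (tmap i q (X q)) *: xi_sub q)) p =
  f p *: sigma i D Y X p.
Proof.
move=> sX sf; rewrite /sigma.
have -> : pushf i (fun q => f q *: (X q + eta (i q) (tmap i q (X q)) *: xi_sub q))
    = fun q => f q *: (pushf i X q + eta (i q) (pushf i X q) *: xi_along q).
  by apply/funext => q; rewrite /pushf tmapZ tmapD tmapZ tmap_xi_sub.
have sX' := smooth_along_pushf (sX p).
have sxi := smooth_along_xi p.
have se : smooth_fun_at (fun q => eta (i q) (pushf i X q)) p.
  exact: (smooth_form imm.1 (metric_lorentzian N).1 sX' sxi).
have sexi := smooth_alongZ se sxi.
rewrite (conn_leibniz pbD.1 _ (sf p) (smooth_alongD sX' sexi)).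
rewrite (conn_add pbD.1 _ sX' sexi) (conn_leibniz pbD.1 _ se sxi).
rewrite {1}/pushf -{1}tmap_xi_sub -tmapZ -tmapD -tmapZ.
rewrite nor_partD nor_part_tmap add0r nor_partZ !nor_partD; congr (_ *: _).
rewrite -tmap_xi_sub -tmapZ nor_part_tmap add0r nor_partZ.
have := sigma_xi Y p; rewrite /sigma pushf_xi_sub => ->.
by rewrite scaler0 addr0.
Qed.

(** The first hypothesis is an equality of fields because [qsm_nor] differentiates [sigma Y Z]; the
    other two terms are only evaluated at [p]. *)
Lemma cov_sigma_zero X Y Z p : (sigma i D Y Z = fun=> 0) ->
  sigma i D (qsm_tan i D X Y) Z p = 0 -> sigma i D Y (qsm_tan i D X Z) p = 0 ->
  cov_sigma i D X Y Z p = 0.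
Proof. by move=> YZ a b; rewrite /cov_sigma YZ a b qsm_nor0 !subr0. Qed.

Lemma cov_sigma_xi_xi Z : cov_sigma i D xi_sub Z xi_sub = fun=> 0.
Proof.
apply/funext => p; apply: cov_sigma_zero.
- by apply/funext => q; exact: sigma_xi.
- exact: sigma_xi.
- by rewrite qsm_tan_xi_xi sigma0.
Qed.

(** It disposes of the third term of the second derivative, where the last argument is the
    derivative of xi along itself. *)
Lemma cov_sigma_0 X Z p : cov_sigma i D X Z (fun=> 0) p = 0.
Proof.
have t0 : qsm_tan i D X (fun=> 0) = fun=> 0.
  by apply/funext => q; exact: qsm_tan0.
apply: cov_sigma_zero; [by apply/funext => q; exact: sigma0|exact: sigma0|].
by rewrite t0 sigma0.
Qed.

(* Every other term of the second covariant derivative vanishes, because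
   [sigma _ xi = 0] and [xi] is parallel along itself. *)
Lemma cov2_sigma_xi X Z p : smooth_vf X ->
  cov2_sigma i D X xi_sub Z xi_sub p =
  (alpha (i p) - 1) ^+ 2 *: sigma i D Z X p.
Proof.
move=> sX; rewrite /cov2_sigma !cov_sigma_xi_xi qsm_nor0 subr0 qsm_tan_xi_xi.
rewrite cov_sigma_0 subr0 sub0r.
(* What is left is the last term of [cov2_sigma], with a minus sign; within it only the last term
   survives, again with a minus sign, so the signs cancel. *)
rewrite /cov_sigma (_ : sigma i D Z xi_sub = fun=> 0); last first.
  by apply/funext => q; exact: sigma_xi.
rewrite qsm_nor0 sigma_xi subr0 !sub0r opprK.
have sf : smooth_fun (fun q => (alpha (i q) - 1) ^+ 2).
  move=> q; have sa : smooth_fun_at (fun r => alpha (i r) - 1) q.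
    apply: smooth_fun_atD; last exact: smooth_fun_at_cst.
    by apply: (smooth_fun_at_comp imm.1 (f := @alpha R n N)); exact: alpha_smooth.
  exact: (smooth_fun_atM sa sa).
rewrite -[RHS](sigmaS Z p sX sf).
(* Two applications of [qsm_tan_xi] give (alpha - 1)^2 phi(phi X), and phi is idempotent because
   eta(phi X) = 0. *)
congr (sigma i D Z _ p); apply/funext => q.
rewrite qsm_tan_xi qsm_tan_xi tmapZ tmapD tmapZ tmap_xi_sub.
rewrite /eta form_scalel form_addl form_scalel xi_unit.
rewrite mulrN1 subrr mulr0 scale0r addr0.
by rewrite scalerA expr2.
Qed.

(** * The two implications *)

Lemma two_recurrent_totally_geodesic : two_recurrent i D -> totally_geodesic i D.
Proof.
case=> psi [_ rec] Z X sZ sX p.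
have := rec X xi_sub Z xi_sub sX smooth_xi_sub sZ smooth_xi_sub p.
rewrite cov2_sigma_xi // sigma_xi scaler0 => /eqP.
rewrite scaler_eq0 sqrf_eq0 subr_eq0 => /orP[/eqP a1|/eqP//].
by case: (alpha1 a1).
Qed.

Lemma totally_geodesic_two_recurrent : totally_geodesic i D -> two_recurrent i D.
Proof.
move=> tg; exists (fun=> 0); split.
  move=> X Y p _ _; rewrite (_ : (fun q => _) = fun=> 0); last first.
    by apply/funext => q; rewrite /form mulmx0 mul0mx mxE.
  exact: smooth_fun_at_cst.
(* Vanishing of the first derivative on all smooth fields suffices: every term of [cov2_sigma] is
   built from such a derivative. *)
have cov0 X Y Z : smooth_vf X -> smooth_vf Y -> smooth_vf Z ->
    cov_sigma i D X Y Z = fun=> 0.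
  move=> sX sY sZ; apply/funext => p; apply: cov_sigma_zero.
  - by apply/funext => q; exact: tg.
  - by apply: tg => //; exact: smooth_qsm_tan.
  - by apply: tg => //; exact: smooth_qsm_tan.
move=> X Y Z W sX sY sZ sW p; rewrite tg // scaler0 /cov2_sigma.
have sT U T : smooth_vf U -> smooth_vf T -> smooth_vf (qsm_tan i D U T).
  exact: smooth_qsm_tan.
by rewrite !cov0 ?qsm_nor0 ?subr0 //; exact: sT.
Qed.

End TotallyGeodesic.

Theorem corollary5p1 (R : realType) (n m : nat) (hmn : (m < n)%N)
    (N : LCS_manifold R n) (M : manifold R m) (i : M -> N)
    (D : M -> 'rV[R]_m -> (M -> 'rV[R]_n) -> 'rV[R]_n) :
  immersion i ->
  pullback_connection i (@nabla R n N) D ->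
  invariant_sub i ->
  (forall q : N, alpha q <> 1%R) ->
  two_recurrent i D <-> totally_geodesic i D.
Proof.
move=> imm pbD inv alpha1; split.
  exact: two_recurrent_totally_geodesic.
exact: totally_geodesic_two_recurrent.
Qed.
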